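(* Let $G$ be an additive abelian group of order $n$, and suppose there exists an $(n,m,k,2)$-strong external difference family in $G$ with $m\geq 3$ and $k\geq 3$. Then \[ \frac{2(k-1)(m-2)}{k(m-1)}\leq 1. \]
   Context: For disjoint subsets $A,B$ of an additive abelian group $G$, let $\mathcal{D}(A,B)$ denote the multiset $\{x-y : x\in A,\ y\in B\}$. An $(n,m,k,\lambda)$-strong external difference family (SEDF) in an additive abelian group $G$ of order $n$ is a set of $m\geq 2$ pairwise disjoint $k$-subsets $A_1,\dots,A_m$ of $G$ such that for every $i$, $1\le i\le m$, the multiset union $\bigcup_{j\neq i}\mathcal{D}(A_i,A_j)$ equals $\lambda(G\setminus\{0\})$, i.e. contains every nonzero element of $G$ exactly $\lambda$ times. *)

(* Defs.v *)
From HB Require Import structures.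
From mathcomp Require Import all_boot all_order all_algebra.

Set Implicit Arguments.
Unset Strict Implicit.
Unset Printing Implicit Defensive.

Import Order.TTheory GRing.Theory Num.Theory.

Local Open Scope ring_scope.

(* Finite multisets over G are sequences considered up to [perm_eq]. *)

Definition diff_multiset (G : finZmodType) (A B : {set G}) : seq G :=
  [seq x - y | x <- enum A, y <- enum B].

(* F is the set {A_1, ..., A_m}; [F :\ A] ranges over the A_j with j <> i when
   A = A_i, and [flatten] is the multiset union (multiplicities add up). *)
Definition is_SEDF (G : finZmodType) (n m k lambda : nat)
    (F : {set {set G}}) : Prop :=
  [/\ #|G| = n,
      (2 <= m)%N /\ #|F| = m,
      {in F, forall A : {set G}, #|A| = k},
      {in F &, forall A B : {set G}, A != B -> [disjoint A & B]}
    & {in F, forall A : {set G},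
        perm_eq (flatten [seq diff_multiset A B | B <- enum (F :\ A)])
                (flatten (nseq lambda (enum [set~ (0 : G)])))}].

(* Main.v *)
Require Import Defs.
From HB Require Import structures.
From mathcomp Require Import all_boot all_order all_algebra.
From mathcomp Require Import zify.

Set Implicit Arguments.
Unset Strict Implicit.
Unset Printing Implicit Defensive.

Import Order.TTheory GRing.Theory Num.Theory.

Local Open Scope ring_scope.

(** Fix a block [A], let [E] be the union of the other blocks, and count the
    quadruples [(x, x', y, y')] in [A * A * E * E] with [x - y = x' - y'].
    Grouping them by the common value [x - y] gives [lambda ^ 2 * (n - 1)].
    Grouping them by [d = x - x']: for [d = 0] there are [k * #|E|] of them,
    while a nonzero [d] has [lambda * (m - 1)] representations as an external
    difference [y - z] with [y] in [E], of which exactly [lambda] have [z] in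
    [A]; hence at least [lambda * (m - 2)] pairs in [E * E] have difference
    [d]. Comparing both counts with [lambda * (n - 1) = k ^ 2 * (m - 1)] gives
    the bound. *)

Section DifferenceCounts.

Variable G : finZmodType.
Implicit Types (A B E : {set G}) (P : {set {set G}}) (g x : G).

(** This is the multiplicity of [g] in [diff_multiset A B]: in a pair with difference [g], the
    element [x] determines its partner [x - g]. *)
Definition diff_count A B g : nat := \sum_(x in A) ((x - g)%R \in B).

Lemma diff_countN A B g : diff_count A B (- g) = diff_count B A g.
Proof.
rewrite /diff_count big_mkcond [RHS]big_mkcond /= (reindex_inj (addIr (- g))) /=.
apply: eq_bigr => x _; rewrite opprK subrK.
by case: (x \in B); case: (x - g \in A).
Qed.

Lemma diff_count_coverl P B g :
  trivIset P -> diff_count (cover P) B g = (\sum_(A in P) diff_count A B g)%N.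
Proof. by move=> tP; rewrite /diff_count big_trivIset. Qed.

Lemma diff_count_coverr P A g :
  trivIset P -> diff_count A (cover P) g = (\sum_(B in P) diff_count A B g)%N.
Proof.
move=> tP; rewrite -diff_countN diff_count_coverl //.
by apply: eq_bigr => B _; rewrite diff_countN.
Qed.

Lemma diff_count_disjoint0 A B : [disjoint A & B] -> diff_count A B 0 = 0%N.
Proof.
move=> dAB; rewrite /diff_count big1 // => x Ax.
by rewrite subr0 (disjointFr dAB Ax).
Qed.

Lemma diff_count_self0 A : diff_count A A 0 = #|A|.
Proof.
by rewrite /diff_count -sum1_card; apply: eq_bigr => x Ax; rewrite subr0 Ax.
Qed.

Lemma count_diff_multiset A B g :
  count_mem g (diff_multiset A B) = diff_count A B g.
Proof.
rewrite /diff_multiset /diff_count count_flatten sumnE !big_map big_enum /=.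
apply: eq_bigr => x _; rewrite count_map -(mem_enum B).
rewrite -(count_uniq_mem _ (enum_uniq _)); apply: eq_count => y /=.
by rewrite subr_eq [g + y]addrC -subr_eq eq_sym.
Qed.

Lemma size_diff_multiset A B : size (diff_multiset A B) = (#|A| * #|B|)%N.
Proof. by rewrite size_allpairs -!cardE. Qed.

(** Both sides count quadruples, since [x - y = x' - y'] is equivalent to [x - x' = y - y']. *)
Lemma sum_diff_count_sqr A E :
  (\sum_g diff_count A E g ^ 2 =
   \sum_(x in A) \sum_(x' in A) diff_count E E (x - x')%R)%N.
Proof.
under eq_bigr => g _ do rewrite -mulnn {1}/diff_count big_distrl /=.
rewrite exchange_big /=; apply: eq_bigr => x _.
under eq_bigr => g _ do rewrite /diff_count big_distrr /=.
rewrite exchange_big /=; apply: eq_bigr => x' _.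
(* With [x] fixed, substituting [g = x - y] turns the sum over [g] into a sum over [y]. *)
rewrite (reindex_inj (inj_comp (addrI x) oppr_inj)) /= /diff_count.
rewrite [RHS]big_mkcond /=; apply: eq_bigr => y _.
rewrite subKr !opprB addrCA.
by case: (y \in E); rewrite ?mul1n ?mul0n.
Qed.

End DifferenceCounts.

Section SEDF.

Variables (G : finZmodType) (n m k lambda : nat) (F : {set {set G}}).
Hypothesis sedfF : is_SEDF n m k lambda F.
Implicit Types (A B : {set G}) (d g : G).

Lemma SEDF_trivIset A : trivIset (F :\ A).
Proof.
have [_ _ _ dF _] := sedfF.
by apply/trivIsetP => B C /setD1P[_ FB] /setD1P[_ FC]; apply: dF.
Qed.

Lemma SEDF_card_others A : A \in F -> #|F :\ A| = m.-1.
Proof. by have [_ [_ <-] _ _ _] := sedfF => FA; rewrite (cardsD1 A F) FA. Qed.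

Lemma SEDF_card_cover A : A \in F -> #|cover (F :\ A)| = (k * m.-1)%N.
Proof.
have [_ _ kF _ _] := sedfF => FA.
rewrite -(eqP (SEDF_trivIset A)) (eq_bigr (fun=> k)); last first.
  by move=> B /setD1P[_ /kF].
by rewrite sum_nat_const SEDF_card_others // mulnC.
Qed.

Lemma SEDF_disjoint A : A \in F -> [disjoint A & cover (F :\ A)].
Proof.
have [_ _ _ dF _] := sedfF => FA.
apply: bigcup_disjoint => B /setD1P[nBA FB].
by apply: dF; rewrite // eq_sym.
Qed.

Lemma SEDF_diff_count A g :
  A \in F -> g != 0 -> diff_count A (cover (F :\ A)) g = lambda.
Proof.
have [_ _ _ _ eqF] := sedfF => FA nz_g.
have /permP/(_ (pred1 g)) := eqF A FA.
rewrite !count_flatten map_nseq sumn_nseq count_uniq_mem ?enum_uniq //.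
rewrite mem_enum in_setC1 nz_g mul1n => <-.
rewrite diff_count_coverr ?SEDF_trivIset // sumnE !big_map big_enum /=.
by apply: eq_bigr => B _; rewrite count_diff_multiset.
Qed.

(** The two multisets in the defining identity for [A] have equal sizes. *)
Lemma SEDF_params A : A \in F -> (lambda * n.-1 = k ^ 2 * m.-1)%N.
Proof.
have [nG _ kF _ eqF] := sedfF => FA.
have /perm_size := eqF A FA.
rewrite !size_flatten /shape map_nseq sumn_nseq -cardE cardsC1 nG => eq_sz.
rewrite mulnC -eq_sz sumnE !big_map big_enum /=.
rewrite (eq_bigr (fun=> (k ^ 2)%N)); last first.
  by move=> B /setD1P[_ FB]; rewrite size_diff_multiset !kF.
by rewrite sum_nat_const SEDF_card_others // mulnC.
Qed.

Lemma SEDF_diff_count_others A d : A \in F -> d != 0 ->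
  (lambda * (m - 2) <= diff_count (cover (F :\ A)) (cover (F :\ A)) d)%N.
Proof.
move=> FA nz_d; set E := cover _.
have tE := SEDF_trivIset A.
suff: (m.-1 * lambda <= lambda + diff_count E E d)%N by nia.
have dEA : diff_count E A d = lambda.
  by rewrite -diff_countN SEDF_diff_count ?oppr_eq0.
(* Splitting [E] into its blocks [B] reduces the inequality to one per block, where [lambda] is the
   count for [B] against all blocks other than [B]. *)
rewrite -{2}dEA !(diff_count_coverl _ _ tE) -big_split -(SEDF_card_others FA) /=.
rewrite -sum_nat_const; apply: leq_sum => B /setD1P[_ FB].
rewrite -(SEDF_diff_count FB nz_d) /diff_count -big_split /=.
(* If [y - d] lies in a block [C] other than [B], then either [C] is [A] or [C] is contained in
   [E]. *)
apply: leq_sum => y _; case: bigcupP => // -[C /setD1P[_ FC] yC].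
have [-> //|nCA] := eqVneq A C; first by rewrite yC.
have -> : y - d \in E by apply/bigcupP; exists C; rewrite // !inE eq_sym nCA.
by rewrite addn1.
Qed.

Lemma SEDF_bound :
  (lambda * (k * k.-1) * (m - 2) <= lambda.-1 * (k ^ 2 * m.-1))%N.
Proof.
have [nG [m_ge2 mF] kF _ _] := sedfF.
have /card_gt0P[A FA] : (0 < #|F|)%N by rewrite mF ltnW.
have := SEDF_params FA; set E := cover (F :\ A) => params.
have : (k * (k * m.-1 + k.-1 * (lambda * (m - 2))) <= n.-1 * lambda ^ 2)%N.
  have -> : (n.-1 * lambda ^ 2 = \sum_g diff_count A E g ^ 2)%N.
    (* The difference 0 contributes nothing, as [A] and [E] are disjoint. *)
    rewrite (bigD1 0) //= diff_count_disjoint0 ?SEDF_disjoint // add0n.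
    rewrite (eq_bigr (fun=> (lambda ^ 2)%N)); last first.
      by move=> g nz_g; rewrite SEDF_diff_count.
    by rewrite sum_nat_const cardC1 nG.
  rewrite sum_diff_count_sqr -{1}(kF A FA) -sum_nat_const.
  apply: leq_sum => x Ax; rewrite (bigD1 x) //= subrr diff_count_self0.
  rewrite SEDF_card_cover // leq_add2l.
  have -> : k.-1 = #|A :\ x| by rewrite -(kF A FA) (cardsD1 x A) Ax.
  rewrite -sum_nat_const (eq_bigl (fun x' => (x' \in A) && (x' != x))).
    apply: leq_sum => x' /andP[_ nx'x].
    by apply: SEDF_diff_count_others; rewrite // subr_eq0 eq_sym.
  by move=> x'; rewrite !inE andbC.
(* By [params] the right side is [lambda * k ^ 2 * m.-1]; removing the diagonal term [k ^ 2 * m.-1]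
   leaves the factor [lambda.-1]. For [lambda = 0] both sides of the goal vanish. *)
by case: lambda params => [|l] /= params; nia.
Qed.

End SEDF.

Theorem theorem3p1 (G : finZmodType) (n m k : nat)
  (hSEDF : exists F : {set {set G}}, is_SEDF n m k 2 F)
  (hm : (3 <= m)%N) (hk : (3 <= k)%N) :
  (2 * (k%:R - 1) * (m%:R - 2)) / (k%:R * (m%:R - 1)) <= 1 :> rat.
Proof.
have [F /SEDF_bound bound] := hSEDF.
have {bound}bound : (2 * k.-1 * (m - 2) <= k * m.-1)%N.
  have k_gt0 : (0 < k)%N by lia.
  (* For [lambda = 2] the factor [lambda.-1] is 1, and a common factor [k] cancels. *)
  by rewrite -(leq_pmul2l k_gt0); nia.
have -> : k%:R - 1 = k.-1%:R :> rat by rewrite -subn1 natrB //; lia.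
have -> : m%:R - 1 = m.-1%:R :> rat by rewrite -subn1 natrB //; lia.
have -> : m%:R - 2 = (m - 2)%:R :> rat by rewrite natrB //; lia.
rewrite ler_pdivrMr ?mul1r -!natrM ?ler_nat // ltr0n; nia.
Qed.
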